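(* Let $s\in\mathbb R^C$, let $y\in\{1,\dots,C\}$ be the true class, let $Q$ be a probability distribution on $\{1,\dots,C\}$, and let $k\ge 1$. Let $y'_1,\dots,y'_k$ be i.i.d. from $Q$, and let the uncorrected sampled softmax estimate of the log-partition function be $\log\bigl(e^{s_y}+\sum_{i=1}^k e^{s_{y'_i}}\bigr)=g(X_k)$ with $X_k=\frac1k\sum_{i=1}^k e^{s_{y'_i}}$ and $g(z)=\log(e^{s_y}+kz)$. Put $\hat\Omega^*=e^{s_y}+k\,\mathbb E_{y'\sim Q}[e^{s_{y'}}]$. Then its delta-method asymptotic bias, curvature bias and variance relative to $\log\sum_j e^{s_j}$ are, respectively, $$\log\frac{e^{s_y}+k\,\mathbb E_{Q}[e^{s_{y'}}]}{\sum_{j=1}^C e^{s_j}},\qquad -\frac{k}{2(\hat\Omega^* )^2}\operatorname{Var}_Q(e^{s_{y'}}),\qquad \frac{k}{(\hat\Omega^* )^2}\operatorname{Var}_Q(e^{s_{y'}}).$$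
   Context: For an estimator of the form $g(X_k)$ of $\log\sum_{j=1}^C e^{s_j}$, where $X_k$ is an average of $k$ i.i.d. random variables with $\mu_X=\mathbb E[X_k]$, $\sigma_X^2=\operatorname{Var}(X_k)$ and $g$ is twice differentiable at $\mu_X$, the (second-order) delta-method quantities are defined as: asymptotic bias $g(\mu_X)-\log\sum_j e^{s_j}$; curvature bias $\tfrac12 g''(\mu_X)\sigma_X^2$; variance $[g'(\mu_X)]^2\sigma_X^2$. $\mathbb E_Q$ and $\operatorname{Var}_Q$ are the expectation and variance for $y'\sim Q$. *)

(* Defs.v *)
From HB Require Import structures.
From mathcomp Require Import all_boot all_order all_algebra.
From mathcomp Require Import all_classical all_reals all_analysis.

Set Implicit Arguments.
Unset Strict Implicit.
Unset Printing Implicit Defensive.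

Import Order.TTheory GRing.Theory Num.Theory.
Import numFieldNormedType.Exports.

Local Open Scope classical_set_scope.
Local Open Scope ring_scope.

(* A measurableType has to be pointed, hence the successor. *)
HB.instance Definition _ (n : nat) := isPointed.Build 'I_n.+1 ord0.

HB.instance Definition _ (n : nat) := @isMeasurable.Build
  default_measure_display 'I_n.+1 discrete_measurable discrete_measurable0
  discrete_measurableC discrete_measurableU.

Section RandomVariables.
Context {d d'} {T : measurableType d} {S : measurableType d'} {R : realType}.
Variable P : probability T R.

Definition mutually_independent (I : finType) (Y : I -> {RV P >-> S}) : Prop :=
  forall (J : {set I}) (B : I -> set S), (forall i, measurable (B i)) ->
    P (\bigcap_(i in [set` J]) (Y i @^-1` B i)) =
    (\prod_(i in J) P (Y i @^-1` B i))%E.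

Definition iid (Q : probability S R) (I : finType) (Y : I -> {RV P >-> S}) :
    Prop :=
  mutually_independent Y /\
  forall i (B : set S), measurable B -> distribution P (Y i) B = Q B.

(* Real-valued versions of 'E_P[X] and 'V_P[X]; meaningful when X is
   square-integrable. *)
Definition mean (X : T -> R) : R := fine 'E_P[X]%E.
Definition var (X : T -> R) : R := fine ('V_P[X])%E.

Definition average (k : nat) (Z : 'I_k -> T -> R) : T -> R :=
  fun w => k%:R^-1 * \sum_(i < k) Z i w.

End RandomVariables.

Definition twice_differentiable_at {R : realType} (g : R -> R) (x : R) : Prop :=
  (\forall z \near x, derivable g z 1) /\ derivable (g^`())%classic x 1.

Section DeltaMethod.
Context {d} {T : measurableType d} {R : realType}.
Variables (P : probability T R) (X : T -> R) (g : R -> R).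

(* The moments of X and the derivatives of g below are then not default
   values. *)
Definition delta_method_applies : Prop :=
  X \in Lfun P 2%:E /\ twice_differentiable_at g (mean P X).

Definition asymptotic_bias (target : R) : R := g (mean P X) - target.

Definition curvature_bias : R := 2^-1 * (g^`(2))%classic (mean P X) * var P X.

Definition delta_variance : R := ((g^`())%classic (mean P X)) ^+ 2 * var P X.

End DeltaMethod.

Section SampledSoftmax.
Context {R : realType} {C : nat}.
Variables (s : 'I_C.+1 -> R) (y : 'I_C.+1).

Definition log_partition : R := ln (\sum_(j < C.+1) expR (s j)).

Definition sampled_log_partition (k : nat) (y' : 'I_k -> 'I_C.+1) : R :=
  ln (expR (s y) + \sum_(i < k) expR (s (y' i))).

Definition softmax_link (k : nat) (z : R) : R := ln (expR (s y) + k%:R * z).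

End SampledSoftmax.

(* Main.v *)
Require Import Defs.
From HB Require Import structures.
From mathcomp Require Import all_boot all_order all_algebra.
From mathcomp Require Import all_classical all_reals all_analysis.
From mathcomp Require Import measurable_realfun ring.

Import Order.TTheory GRing.Theory Num.Theory.
Import numFieldNormedType.Exports.

Local Open Scope classical_set_scope.
Local Open Scope ring_scope.

(** The i.i.d. samples give [X] mean [E_Q[e^s]] and variance [Var_Q(e^s) / k]:
    the moments of each [e^{s_{y'_i}}] are read off its distribution [Q], and
    distinct summands are uncorrelated because independence factors the joint
    law on the finite label set. The link [g z = ln (e^{s_y} + k z)] satisfies
    [g' = k / (e^{s_y} + k z)] and [g'' = - (g')^2] wherever its argument is
    positive, in particular near [E_Q[e^s] >= 0]. *)

Section moments.
Context {d} {T : measurableType d} {R : realType} (P : probability T R).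

(** Since [P] has total mass 1, the constant [M ^ 2] is an integrable majorant of [|f| ^ 2]. *)
Lemma Lfun2_bounded (f : T -> R) (M : R) :
  measurable_fun setT f -> (forall x, `|f x| <= M) -> f \in Lfun P 2%:E.
Proof.
move=> mf fM; rewrite inE; apply/andP; split; rewrite inE//=.
rewrite /finite_norm unlock poweR_lty//.
have mf2 : measurable_fun setT (fun x => `|f x| `^ 2).
  apply: (@measurableT_comp _ _ _ _ _ _ (@powR R ^~ 2)) => //.
  exact: measurableT_comp.
apply: (@le_lt_trans _ _ (\int[P]_x (cst (M `^ 2)%:E x))%E).
  apply: ge0_le_integral => //.
  - by move=> x _; exact: poweR_ge0.
  - exact/measurable_EFinP.
  - move=> x _; rewrite /= lee_fin.
    have M0 : 0 <= M by exact: le_trans (fM x).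
    by rewrite ge0_ler_powR// ?nnegrE.
by rewrite integral_cst//= probability_setT mule1 ltry.
Qed.

(** [h \o Z] is a finite combination of indicators of the fibres of [Z], so linearity of the
    integral applies. *)
Lemma expectation_finite_valued (F : finType) (Z : T -> F) (h : F -> R) :
  (forall a, measurable (Z @^-1` [set a])) ->
  ('E_P[fun w => h (Z w)] =
   (\sum_(a : F) h a * fine (P (Z @^-1` [set a])))%:E)%E.
Proof.
move=> mZ; rewrite unlock.
have -> : (fun w => (h (Z w))%:E) =
    (fun w => \sum_(a : F) ((h a)%:E * (\1_(Z @^-1` [set a]) w)%:E))%E.
  apply/funext => w; rewrite (bigD1 (Z w))//= indicE mem_set//= mule1.
  rewrite big1 ?adde0// => a aZ.
  by rewrite indicE memNset/= ?mule0// => /= /eqP; rewrite eq_sym (negbTE aZ).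
have intI a : P.-integrable setT (EFin \o \1_(Z @^-1` [set a])).
  exact: integrable_indic.
rewrite integral_sum// => [|a]; last exact: integrableZl (intI a).
rewrite -sumEFin; apply: eq_bigr => a _.
rewrite (integralZl _ (intI a))//= integral_indic// setIT EFinM fineK//.
exact: fin_num_measure.
Qed.

(** The product is a function of the pair [(X, Y)], whose values lie in the finite type [F * G].
    Factoring the mass of each atom turns its expectation into a double sum that splits as a product
    of expectations. *)
Lemma covariance_independent_finite (F G : finType) (X : T -> F) (Y : T -> G)
    (f : F -> R) (g : G -> R) :
  (forall a, measurable (X @^-1` [set a])) ->
  (forall b, measurable (Y @^-1` [set b])) ->
  (forall a b, P (X @^-1` [set a] `&` Y @^-1` [set b]) =
    P (X @^-1` [set a]) * P (Y @^-1` [set b]))%E ->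
  f \o X \in Lfun P 2%:E -> g \o Y \in Lfun P 2%:E ->
  covariance P (f \o X) (g \o Y) = 0%E.
Proof.
move=> mX mY XY fX gY.
have P1 : P setT \is a fin_num by exact: fin_num_measure.
rewrite covarianceE ?Lfun2_mul_Lfun1 ?Lfun_subset12//.
have XYE a : (fun w => (X w, Y w)) @^-1` [set a] =
    X @^-1` [set a.1] `&` Y @^-1` [set a.2].
  by case: a => a b; apply/seteqP; split => w /= [-> ->].
have mXY a : measurable ((fun w => (X w, Y w)) @^-1` [set a]).
  by rewrite XYE; exact: measurableI.
have -> : ((f \o X) * (g \o Y))%R =
    (fun w => (fun p => f p.1 * g p.2) (X w, Y w)) by [].
rewrite (expectation_finite_valued _ _ (fun p => f p.1 * g p.2) mXY).
rewrite !expectation_finite_valued// -EFinM mulr_suml.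
under [X in (_ - X%:E)%E]eq_bigr do rewrite mulr_sumr.
rewrite pair_bigA /= -EFinB; apply/eqP; rewrite eqe subr_eq0; apply/eqP.
apply: eq_bigr => -[a b] _ /=; rewrite XYE XY fineM ?fin_num_measure//=.
by rewrite mulrACA.
Qed.

Lemma Lfun2_sum (I : Type) (h : I -> T -> R) (s : seq I) :
  (forall i, h i \in Lfun P 2%:E) -> \sum_(i <- s) h i \in Lfun P 2%:E.
Proof.
move=> hL; elim: s => [|i s ih]; first by rewrite big_nil; exact: Lfun_cst.
by rewrite big_cons rpredD ?lee1n.
Qed.

(** Splitting off the head of the list leaves a cross term, its covariance with the sum of the tail.
    Uniqueness keeps the head distinct from every later index, so an inner induction, by additivity
    of covariance, makes that term vanish. *)
Lemma variance_sum_uncorrelated (I : eqType) (h : I -> T -> R) (s : seq I) :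
  uniq s -> (forall i, h i \in Lfun P 2%:E) ->
  (forall i j, i != j -> covariance P (h i) (h j) = 0)%E ->
  ('V_P[(\sum_(i <- s) h i)%R] = \sum_(i <- s) 'V_P[h i])%E.
Proof.
move=> + hL hcov; elim: s => [_|i s ih /= /andP[si us]].
  by rewrite !big_nil; exact: variance_cst.
rewrite !big_cons varianceD ?Lfun2_sum// ih//.
suff -> : (covariance P (h i) (\sum_(j <- s) h j)%R = 0)%E by rewrite mule0 adde0.
elim: s si {us ih} => [_|j s ih]; first by rewrite big_nil covariance_cst_r.
rewrite inE negb_or => /andP[ij si].
by rewrite big_cons covarianceDr ?Lfun2_sum// hcov// ih// adde0.
Qed.

End moments.

Section identically_distributed.
Context {d d'} {T : measurableType d} {S : measurableType d'} {R : realType}.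
Variables (P : probability T R) (Q : probability S R) (Y : {RV P >-> S}).
Hypothesis YQ : forall B, measurable B -> distribution P Y B = Q B.

Lemma expectation_id_distributed (f : S -> R) : measurable_fun setT f ->
  f \o Y \in Lfun P 1 -> ('E_P[f \o Y] = 'E_Q[f])%E.
Proof.
move=> mf /Lfun1_integrable fY; rewrite unlock.
transitivity (\int[distribution P Y]_y (f y)%:E)%E; last first.
  by apply: eq_measure_integral => B mB _; exact: YQ.
by rewrite integral_distribution//; exact/measurable_EFinP.
Qed.

(** Once the two means agree, both variances are centred at one constant [c], and the squared
    deviation is again a function of [Y] whose expectation transfers. *)
Lemma variance_id_distributed (f : S -> R) : measurable_fun setT f ->
  f \o Y \in Lfun P 2%:E -> ('V_P[f \o Y] = 'V_Q[f])%E.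
Proof.
move=> mf fY.
have P1 : P setT \is a fin_num by exact: fin_num_measure.
rewrite /variance !covariance.unlock.
rewrite expectation_id_distributed ?Lfun_subset12//.
set c := fine _.
have fcL : (f \o Y \- cst c) \in Lfun P 2%:E.
  by rewrite rpredB ?lee1n// => ?; exact: Lfun_cst.
rewrite -expectation_id_distributed//; last exact: Lfun2_mul_Lfun1.
by apply: measurable_funM; apply: measurable_funB.
Qed.

End identically_distributed.

Section softmax_link_derivatives.
Context {R : realType} {C : nat}.
Variables (s : 'I_C.+1 -> R) (y : 'I_C.+1) (k : nat).

Let D z := expR (s y) + k%:R * z.

Lemma is_derive_denominator (z : R) : is_derive z 1 D k%:R.
Proof.
by rewrite /D; apply: is_derive_eq; rewrite add0r /GRing.scale/=; ring.
Qed.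

Lemma is_derive_softmax_link z : 0 < D z ->
  is_derive z 1 (softmax_link s y k) (k%:R / D z).
Proof.
move=> Dz; have dD := is_derive_denominator z.
have dln := is_derive1_ln Dz.
have := is_derive1_comp dln dD.
by rewrite mulrC.
Qed.

Lemma near_denominator_gt0 z : 0 < D z -> \forall t \near z, 0 < D t.
Proof.
move=> Dz; have cD : {for z, continuous D}.
  by apply: cvgD; [exact: cvg_cst|apply: cvgM; [exact: cvg_cst|exact: cvg_id]].
exact: cvgr_gt cD _ Dz.
Qed.

Lemma is_derive2_softmax_link z : 0 < D z ->
  is_derive z 1 ((softmax_link s y k)^`())%classic (- (k%:R / D z) ^+ 2).
Proof.
move=> Dz.
(* The formula for the first derivative holds only where [D] is positive; a neighbourhood of [z] is
   enough to differentiate it again. *)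
apply: (@near_eq_is_derive _ _ _ (fun t => k%:R *: (D t)^-1)).
  near=> t; have Dt : 0 < D t by near: t; exact: near_denominator_gt0.
  by rewrite derive1E; have [_ ->] := is_derive_softmax_link t Dt.
have dD := is_derive_denominator z.
have dV := is_deriveV (lt0r_neq0 Dz) dD.
apply: is_derive_eq; rewrite /GRing.scale/= exprMn exprVn; ring.
Unshelve. all: by end_near. Qed.

End softmax_link_derivatives.

Theorem mainTheorem13 (R : realType) (C k : nat) (hk : (1 <= k)%N)
    (s : 'I_C.+1 -> R) (y : 'I_C.+1) (Q : probability 'I_C.+1 R)
    (d : measure_display) (T : measurableType d) (P : probability T R)
    (y' : 'I_k -> {RV P >-> 'I_C.+1}) (y'_iid : iid Q y') :
  let X := average (fun i w => expR (s (y' i w))) in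
  let g := softmax_link s y k in
  let EQ := mean Q (fun j => expR (s j)) in
  let VarQ := var Q (fun j => expR (s j)) in
  let Omega := expR (s y) + k%:R * EQ in
  [/\ forall w, sampled_log_partition s y (fun i => y' i w) = g (X w),
      delta_method_applies P X g,
      asymptotic_bias P X g (log_partition s) =
        ln ((expR (s y) + k%:R * EQ) / \sum_(j < C.+1) expR (s j)),
      curvature_bias P X g = - (k%:R / (2 * Omega ^+ 2)) * VarQ &
      delta_variance P X g = k%:R / Omega ^+ 2 * VarQ].
Proof.
move=> X g EQ VarQ Omega; case: y'_iid => y'_indep y'_Q.
have k0 : k%:R != 0 :> R by rewrite pnatr_eq0 -lt0n.
pose f j := expR (s j).
have mf : measurable_fun setT f by [].
have P1 : P setT \is a fin_num by exact: fin_num_measure.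
have fYL i : f \o y' i \in Lfun P 2%:E.
  (* Each value of [f] is one term of this sum of nonnegative numbers, so the sum bounds them
     all. *)
  apply: (@Lfun2_bounded _ _ _ _ _ (\sum_j f j)).
    exact: measurableT_comp.
  move=> w; rewrite ger0_norm ?expR_ge0// (bigD1 (y' i w))//= lerDl.
  by apply: sumr_ge0 => j _; exact: expR_ge0.
have mY i (A : set 'I_C.+1) : measurable (y' i @^-1` A).
  by rewrite -[X in measurable X]setTI; exact: (measurable_funPT (y' i)).
have covY i j : i != j -> (covariance P (f \o y' i) (f \o y' j) = 0)%E.
  move=> ij; apply: covariance_independent_finite => [a|b|a b|//|//]; [exact: mY|exact: mY|].
  (* Mutual independence is used on the index pair [i], [j] only; the value of [B] at other indices
     does not enter the intersection. *)
  pose B l : set 'I_C.+1 := if l == i then [set a] else [set b].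
  have := y'_indep [set i; j]%SET B (fun=> I).
  rewrite big_setU1 ?inE//= big_set1 /B eqxx eq_sym (negbTE ij) => <-.
  congr (P _); apply/seteqP; split => [w [ia jb] l|w h].
    by rewrite /= !inE => /orP[] /eqP ->; rewrite ?eqxx// eq_sym (negbTE ij).
  split; first by have := h i; rewrite /= !inE eqxx; apply.
  by have := h j; rewrite /= !inE eqxx orbT eq_sym (negbTE ij); apply.
pose S := \sum_(i < k) (f \o y' i).
have SL : S \in Lfun P 2%:E by exact: Lfun2_sum.
have XE : X = k%:R^-1 \o* S.
  by apply/funext => w; rewrite /X /average /S /= fct_sumE mulrC.
(* Finiteness of the moments under [Q], without which [fine] would return a default value, is
   inherited from the sample of index 0, which exists because [k >= 1]. *)
have Qf1 : ('E_Q[f] = EQ%:E)%E.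
  rewrite fineK// -(expectation_id_distributed _ _ _ (y'_Q (Ordinal hk)))//.
    by rewrite expectation_fin_num// Lfun_subset12.
  by rewrite Lfun_subset12.
have Qf2 : ('V_Q[f] = VarQ%:E)%E.
  rewrite fineK// -(variance_id_distributed _ _ _ (y'_Q (Ordinal hk)))//.
  exact: variance_fin_num.
have meanX : mean P X = EQ.
  rewrite /mean XE expectationZl ?Lfun_subset12// /S -(big_map _ xpredT id).
  rewrite expectation_sum => [|_ /mapP[i _ ->]]; last by rewrite Lfun_subset12.
  rewrite big_map (eq_bigr (fun=> EQ%:E)) => [|i _]; last first.
    by rewrite (expectation_id_distributed _ _ _ (y'_Q i))// Lfun_subset12.
  by rewrite sumEFin sumr_const card_ord /= -(mulr_natl EQ) mulKf.
(* Scaling contributes [k ^- 2] and the [k] uncorrelated summands contribute [k * VarQ]. *)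
have varX : var P X = VarQ / k%:R.
  rewrite /var XE varianceZ// /S variance_sum_uncorrelated//; last first.
    exact: index_enum_uniq.
  rewrite (eq_bigr (fun=> VarQ%:E)) => [|i _]; last first.
    by rewrite (variance_id_distributed _ _ _ (y'_Q i)).
  rewrite sumEFin sumr_const card_ord /= -(mulr_natl VarQ).
  by field.
have Omega0 : 0 < Omega.
  rewrite ltr_pwDl ?expR_gt0// mulr_ge0// fine_ge0//.
  by apply: expectation_ge0 => j; exact: expR_ge0.
have dg := is_derive_softmax_link s y k.
have d2g := is_derive2_softmax_link s y k _ Omega0.
split.
- by move=> w; rewrite /sampled_log_partition /g /softmax_link /X /average mulVKf.
- split; first by rewrite XE Lfun_scale// ler1n.
  rewrite meanX; split; last by case: d2g.
  near=> z.
  have Dz : 0 < expR (s y) + k%:R * z by near: z; exact: near_denominator_gt0.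
  by case: (dg z Dz).
(* The logarithm of the quotient splits because [Omega] is positive and the partition sum is at
   least its term [expR (s y)]. *)
- rewrite /asymptotic_bias meanX ln_div// posrE.
  apply: (lt_le_trans (expR_gt0 (s y))); rewrite (bigD1 y)//= lerDl.
  by apply: sumr_ge0 => j _; exact: expR_ge0.
(* The factor [k ^+ 2] of the second derivative meets [VarQ / k], so a single [k] survives in the
   numerator; the variance below simplifies in the same way. *)
- rewrite /curvature_bias meanX varX derive1nS derive1n1 derive1E.
  have [_ ->] := d2g; rewrite -/Omega.
  by field; rewrite k0 gt_eqF.
- rewrite /delta_variance meanX varX derive1E.
  have [_ ->] := dg EQ Omega0; rewrite -/Omega.
  by field; rewrite k0 gt_eqF.
Unshelve. all: by end_near. Qed.
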